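(* Let $J\geq2$ be an integer, let $\mathrm{B}$ be a symplectic form on a vector space $\mathcal{V}$ over $\mathbb{F}_2$ of dimension $2J$, and let $\mathcal{D}$ be an affine quadric in $\mathcal{V}$ with $\#(\mathcal{D})=2^{J-1}(2^J+1)$. Let $\Psi_{\mathcal{D}}$ and $\widehat{\Psi}_{\mathcal{D}}$ be the dual ETFs defined in the context. Then $\operatorname{bin}(\widehat{\Psi}_{\mathcal{D}})$ is empty when $J>4$. When instead $J\in\{2,3,4\}$, it forms a BIBD with the following $(V,K,\Lambda,R,B)$ parameters: \[ J=2:\ (10,4,2,6,15),\qquad J=3:\ (36,6,8,56,336),\qquad J=4:\ (136,10,64,960,13056). \] In these three cases, every member of either $\operatorname{bin}(\Psi_{\mathcal{D}})$ or $\operatorname{bin}(\widehat{\Psi}_{\mathcal{D}})$ is an oval of the (BIBD formed by the) other.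
   Context: A symplectic form is an alternating nondegenerate bilinear form. A function $\mathrm{Q}:\mathcal{V}\to\mathbb{F}_2$ is a quadratic form that yields $\mathrm{B}$ if $\mathrm{B}(v_1,v_2)=\mathrm{Q}(v_1+v_2)+\mathrm{Q}(v_1)+\mathrm{Q}(v_2)$ for all $v_1,v_2\in\mathcal{V}$; its quadric is $\{v\in\mathcal{V}:\mathrm{Q}(v)=0\}$. A subset $\mathcal{D}\subseteq\mathcal{V}$ is an affine quadric if either $\mathcal{D}$ or its complement $\mathcal{D}^{\mathrm{c}}$ is the quadric of some quadratic form that yields $\mathrm{B}$. ETFs: a finite sequence $(\varphi_n)_{n\in\mathcal{N}}$ in a real Hilbert space ($\mathcal{N}$ finite, nonempty) is an equiangular tight frame (ETF) if $\|\varphi_n\|^2=S$ for all $n$ for some $S>0$, $|\langle\varphi_{n_1},\varphi_{n_2}\rangle|^2=C$ for all $n_1\neq n_2$ for some $C>0$, and for some $A>0$, $\sum_n\langle\varphi_n,y\rangle\varphi_n=Ay$ for all $y$ in its span. For nonempty $\mathcal{K}\subseteq\mathcal{N}$, $(\varphi_n)_{n\in\mathcal{K}}$ is a regular simplex if it is an ETF whose span has dimension $\#(\mathcal{K})-1$. The binder of an ETF $(\varphi_n)_{n\in\mathcal{N}}$, denoted $\operatorname{bin}$, is the set of all $\mathcal{K}\subseteq\mathcal{N}$ such that $(\varphi_n)_{n\in\mathcal{K}}$ is a regular simplex. The sequences: $\Psi_{\mathcal{D}}=(\psi_v)_{v\in\mathcal{D}}$ in $\mathbb{R}^{\mathcal{D}^{\mathrm{c}}}$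 is given by $\psi_{v_2}(v_1)=2^{-(J-1)/2}(-1)^{\mathrm{B}(v_1,v_2)}$ for $v_1\in\mathcal{D}^{\mathrm{c}}$, $v_2\in\mathcal{D}$; it is known that $\langle\psi_{v_1},\psi_{v_2}\rangle=2^J-1$ if $v_1=v_2$ and $-(-1)^{\mathrm{B}(v_1,v_2)}$ if $v_1\neq v_2$ in $\mathcal{D}$. Its dual $\widehat{\Psi}_{\mathcal{D}}=(\widehat{\psi}_v)_{v\in\mathcal{D}}$ is a sequence in a real Hilbert space (unique up to isometry of spans) with $\langle\widehat{\psi}_{v_1},\widehat{\psi}_{v_2}\rangle=2^{J-1}+1$ if $v_1=v_2$ and $(-1)^{\mathrm{B}(v_1,v_2)}$ if $v_1\neq v_2$. It is known that $\Psi_{\mathcal{D}}$ and $\widehat{\Psi}_{\mathcal{D}}$ are $2^{J-1}(2^J+1)$-vector ETFs whose spans have dimensions $\frac13(2^{2J}-1)$ and $\frac13(2^{J-1}+1)(2^J+1)$, respectively. BIBDs: a BIBD with parameters $(V,K,\Lambda,R,B)$ consists of a vertex set of size $V$ and a sequence of $B\geq1$ subsets (blocks), all of size $K\geq2$, such that any two distinct vertices are contained together in exactly $\Lambda$ blocks (and then every vertex lies in exactly $R$ blocks). A set of subsets forms a BIBD if an enumeration of it without repetition is the block sequence of a BIBD; here the vertex set is $\mathcal{D}$. ($\operatorname{bin}(\Psi_{\mathcal{D}})$ is also known to form a BIBD over $\mathcal{D}$.) An oval of a BIBD is a nonempty subset of its vertex set that meets every block in exactly $0$ or $2$ vertices (equivalently,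 a subset of size $\frac{V-1}{K-1}+1$ meeting every block in at most $2$ vertices). *)

(* Defs.v *)
From HB Require Import structures.
From mathcomp Require Export all_boot all_order all_algebra all_field.
From mathcomp Require Export sesquilinear.
From mathcomp Require Export boolp reals.

Set Implicit Arguments.
Unset Strict Implicit.
Unset Printing Implicit Defensive.

Import Order.TTheory GRing.Theory Num.Theory.
Local Open Scope ring_scope.

(* Sequences are indexed by a finite type [N]; the notions below are stated for
   the subsequence indexed by [K : {set N}].  [E] is an arbitrary real inner
   product space: every notion only involves finite-dimensional spans, which
   are automatically complete. *)
Section Frames.

Variables (R : realType) (E : lmodType R) (ip : {dot E for idfun}).
Variables (N : finType) (phi : N -> E).

Definition in_span (K : {set N}) (y : E) : Prop :=
  exists c : N -> R, y = \sum_(n in K) c n *: phi n.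

Definition span_dim (K : {set N}) (d : nat) : Prop :=
  exists b : 'I_d -> E,
    (forall c : 'I_d -> R, \sum_i c i *: b i = 0 -> forall i, c i = 0) /\
    (forall y, in_span K y <-> exists c : 'I_d -> R, y = \sum_i c i *: b i).

Definition is_ETF (K : {set N}) : Prop :=
  [/\ K != set0,
      exists2 S : R, 0 < S & forall n, n \in K -> ip (phi n) (phi n) = S,
      exists2 C : R, 0 < C &
        forall n1 n2, n1 \in K -> n2 \in K -> n1 != n2 ->
          `|ip (phi n1) (phi n2)| ^+ 2 = C
    & exists2 A : R, 0 < A &
        forall y, in_span K y ->
          \sum_(n in K) ip (phi n) y *: phi n = A *: y].

Definition regular_simplex (K : {set N}) : Prop :=
  is_ETF K /\ span_dim K #|K|.-1.

Definition bin : {set {set N}} := [set K | `[< regular_simplex K >]].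

End Frames.

Section Designs.

Variable T : finType.

Definition is_BIBD (blocks : seq {set T}) (V K L r b : nat) : Prop :=
  [/\ #|T| = V,
      (1 <= b)%N /\ size blocks = b,
      (2 <= K)%N /\ (forall X, X \in blocks -> #|X| = K),
      forall x y : T, x != y ->
        count (fun X : {set T} => (x \in X) && (y \in X)) blocks = L
    & forall x : T, count (fun X : {set T} => x \in X) blocks = r].

Definition forms_BIBD (A : {set {set T}}) (V K L r b : nat) : Prop :=
  is_BIBD (enum A) V K L r b.

Definition oval (blocks : seq {set T}) (O : {set T}) : Prop :=
  O != set0 /\
  forall X, X \in blocks -> #|O :&: X| = 0%N \/ #|O :&: X| = 2%N.

End Designs.

Section Euclidean.

Variables (R : realType) (I : finType).
Implicit Types x y : {ffun I -> R^o}.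

Definition dotf x y : R := \sum_i x i * y i.

Fact dotf_bilinear :
  bilinear_for (GRing.Scale.Law.clone _ _ ( *%R ) _)
               (GRing.Scale.Law.clone _ _ (idfun \; *%R) _) dotf.
Proof.
split=> u a x y /=; rewrite /dotf mulr_sumr -big_split;
  apply: eq_bigr => i _ /=; rewrite !ffunE.
  by rewrite mulrDl mulrA.
by rewrite mulrDr mulrCA.
Qed.

HB.instance Definition _ :=
  bilinear_isBilinear.Build R {ffun I -> R^o} {ffun I -> R^o} R
    *%R (idfun \; *%R) dotf dotf_bilinear.

Fact dotf_sym x y : dotf x y = (-1) ^+ false * idfun (dotf y x).
Proof. by rewrite expr0 mul1r; apply: eq_bigr => i _; rewrite mulrC. Qed.

HB.instance Definition _ :=
  isHermitianSesquilinear.Build R {ffun I -> R^o} false idfun dotf dotf_sym.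

Fact dotf_gt0 x : x != 0 -> 0 < dotf x x.
Proof.
move=> xN0; rewrite lt_def sumr_ge0 ?andbT; last first.
  by move=> i _; rewrite -expr2 sqr_ge0.
apply: contra xN0; rewrite psumr_eq0 => [/allP x0|i _]; last first.
  by rewrite -expr2 sqr_ge0.
apply/eqP/ffunP => i; rewrite ffunE; apply/eqP.
by have := x0 i; rewrite mem_index_enum mulf_eq0 orbb; apply.
Qed.

HB.instance Definition _ :=
  isDotProduct.Build R {ffun I -> R^o} dotf dotf_gt0.

Definition euclidean : {dot {ffun I -> R^o} for idfun} := dotf.

End Euclidean.

Section Quadrics.

Variables (V : vectType 'F_2) (B : {skew_symmetric V}).

Definition yields (Q : V -> 'F_2) : Prop :=
  forall v1 v2 : V, B v1 v2 = Q (v1 + v2) + Q v1 + Q v2.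

(* [finvect_type V] is [V], equipped with its finite type structure. *)
Definition quadric (Q : V -> 'F_2) : {set finvect_type V} :=
  [set v : finvect_type V | Q v == 0].

Definition affine_quadric (D : {set finvect_type V}) : Prop :=
  exists Q : V -> 'F_2, yields Q /\ (D = quadric Q \/ ~: D = quadric Q).

Variables (R : realType) (J : nat) (D : {set finvect_type V}).

Definition sgB (v1 v2 : V) : R := (-1) ^+ nat_of_ord (B v1 v2).

Definition Psi (v2 : {v | v \in D}) : {ffun {v | v \in ~: D} -> R^o} :=
  [ffun v1 : {v | v \in ~: D} =>
    (Num.sqrt 2 ^- J.-1 * sgB (val v1) (val v2) : R^o)].

(* The dual sequence is only determined up to isometry of spans, by its Gram
   matrix. *)
Definition is_dual_Psi (E : lmodType R) (ip : {dot E for idfun})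
    (phi : {v | v \in D} -> E) : Prop :=
  forall v1 v2,
    ip (phi v1) (phi v2) =
    if v1 == v2 then 2 ^+ J.-1 + 1 else sgB (val v1) (val v2).

End Quadrics.

(* Main.v *)
Require Import Defs.
From mathcomp Require Import finalg ring lra zify.
Import Order.TTheory GRing.Theory Num.Theory.
Local Open Scope ring_scope.

Set Implicit Arguments.
Unset Strict Implicit.

(* In a frame with squared norms S > 1 and inner products +-1, the Gram matrix
   of a regular simplex K is S + 1 times a corank one projection; hence K is a
   regular simplex iff #K = S + 1 and the product of the three inner products
   is -1 for all triples in K.  In terms of B, the members of the binder of the
   dual ETF are the sets K in D of 2^(J-1) + 2 points such that
   B(x,y) + B(y,z) + B(x,z) = 1 for all triples, and the members of the binder
   of Psi_D are the sets of 2^J points for which this sum is 0.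

   Translating by a point of K, a set of the first kind becomes a "clique": a
   set of 2^(J-1) + 1 singular vectors that pairwise satisfy B = 1.  Distinct
   subsets of a clique of even size have distinct sums, so that
   2^(2^(J-1)) <= 2^(2J) and J <= 4.  A character sum gives the number of
   one-point extensions of a clique with independent elements; as it only
   depends on the size of the clique, the cliques through a given vector can be
   counted, which yields Lambda, then R and B by double counting.

   A set of the first kind and a set of the second kind have at most two points
   in common.  The sets of the first kind through a point x of a
   set K of the second kind meet K in (2^J - 1) Lambda = R further points in
   all, hence in exactly one further point each. *)

(** * Regular simplices and Gram matrices *)

Lemma mxrank_le1_minor (F : fieldType) m n (X : 'M[F]_(m, n)) :
  (\rank X <= 1)%N ->
  forall i j k l, X i j * X k l = X i l * X k j.
Proof.
move: (col_base X) (row_base X) (mulmx_base X).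
case: (\rank X) => [|[|//]] C D <- _ i j k l; rewrite !mxE.
  by rewrite !big_ord0 !mul0r.
by rewrite !big_ord1; ring.
Qed.

Lemma sum_enum_val (V : nmodType) (I : finType) (K : {set I}) (F : I -> V) :
  \sum_(n in K) F n = \sum_(i < #|K|) F (enum_val i).
Proof. exact: big_enum_val. Qed.

Section Simplices.

Variables (R : realType) (E : lmodType R) (ip : {dot E for idfun}).
Variables (N : finType) (phi : N -> E).

Lemma ipC x y : ip x y = ip y x.
Proof. by rewrite hermC expr0 mul1r. Qed.

Lemma ip_suml (I : finType) (P : pred I) (c : I -> R) (f : I -> E) y :
  ip (\sum_(i | P i) c i *: f i) y = \sum_(i | P i) c i * ip (f i) y.
Proof. by rewrite linear_sumlz; apply: eq_bigr => i _; rewrite linearZl_LR. Qed.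

Lemma ip_eq0 x : ip x x = 0 -> x = 0.
Proof.
move=> x0; apply/eqP; apply: contraT => xN0.
by have := neq0_dnorm_gt0 (s := ip) x xN0; rewrite x0 ltxx.
Qed.

Lemma in_span_phi (K : {set N}) n : n \in K -> in_span phi K (phi n).
Proof.
move=> nK; exists (fun m => (m == n)%:R).
rewrite (bigD1 n) //= eqxx scale1r big1 ?addr0 // => m /andP[_ /negPf ->].
by rewrite scale0r.
Qed.

Variables (S : R) (S_gt1 : 1 < S).
Hypothesis ip_diag : forall n, ip (phi n) (phi n) = S.
Hypothesis ip_offdiag : forall m n, m != n -> ip (phi m) (phi n) ^+ 2 = 1.

(** Triangle products do not change when some of the vectors are negated. *)
Definition neg_triples (K : {set N}) := forall a b c,
  a \in K -> b \in K -> c \in K -> a != b -> b != c -> a != c ->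
  ip (phi a) (phi b) * ip (phi b) (phi c) * ip (phi a) (phi c) = -1.

(** Tightness gives [(A - G) M = 0], with [G] the Gram matrix and [M] the coordinates of the vectors
    in a basis of the span. As [M] has rank #K - 1, the matrix [A - G] has rank at most one and its
    2 x 2 minors vanish. *)
Lemma simplex_neg_triples (K : {set N}) :
  regular_simplex ip phi K -> #|K|%:R = S + 1 /\ neg_triples K.
Proof.
case=> -[Kn0 _ _ [A A_gt0 tight]] [b [b_free b_span]].
have K_gt0 : (0 < #|K|)%N by rewrite card_gt0.
set d := #|K|.-1 in b b_free b_span.
have /choice [M ME] : forall i : 'I_#|K|, exists c : 'I_d -> R,
    phi (enum_val i) = \sum_j c j *: b j.
  by move=> i; apply/b_span/in_span_phi/enum_valP.
have /choice [L LE] : forall j : 'I_d, exists c : N -> R,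
    b j = \sum_(n in K) c n *: phi n.
  move=> j; apply/b_span; exists (fun i => (i == j)%:R).
  rewrite (bigD1 j) //= eqxx scale1r big1 ?addr0 // => i /negPf ->.
  by rewrite scale0r.
have b_inj (c c' : 'I_d -> R) :
    \sum_j c j *: b j = \sum_j c' j *: b j -> c =1 c'.
  move=> /eqP; rewrite -subr_eq0 -sumrB => /eqP eq0 j; apply/eqP.
  rewrite -subr_eq0; apply/eqP; apply: (b_free (fun j => c j - c' j)).
  by rewrite -[RHS]eq0; apply: eq_bigr => i _; rewrite scalerBl.
pose Mx := \matrix_(i, j) M i j : 'M[R]_(#|K|, d).
pose Lx := \matrix_(j, i) L j (enum_val i) : 'M[R]_(d, #|K|).
(* The left inverse shows that [Mx] has rank [d]. *)
have LM : Lx *m Mx = 1%:M.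
  apply/matrixP => j j'; rewrite !mxE.
  under eq_bigr do rewrite !mxE.
  apply: (b_inj (fun j' => \sum_i L j (enum_val i) * M i j')
                (fun j' => (j == j')%:R)).
  transitivity (b j); last first.
    rewrite (bigD1 j) //= eqxx scale1r big1 ?addr0 // => i.
    by rewrite eq_sym => /negPf ->; rewrite scale0r.
  rewrite LE sum_enum_val; under [RHS]eq_bigr => i _ do rewrite ME scaler_sumr.
  rewrite exchange_big /=; apply: eq_bigr => i _; rewrite scaler_suml.
  by apply: eq_bigr => l _; rewrite scalerA.
pose G := \matrix_(i, j) ip (phi (enum_val i)) (phi (enum_val j))
          : 'M[R]_#|K|.
pose X := A%:M - G.
have XM : X *m Mx = 0.
  rewrite mulmxBl mul_scalar_mx; apply/eqP; rewrite subr_eq0; apply/eqP.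
  apply/matrixP => m j; rewrite !mxE; under eq_bigr do rewrite !mxE.
  apply: (b_inj (fun j => A * M m j) (fun j => \sum_i
      ip (phi (enum_val m)) (phi (enum_val i)) * M i j)).
  transitivity (A *: phi (enum_val m)).
    by rewrite ME scaler_sumr; apply: eq_bigr => i _; rewrite scalerA.
  rewrite -(tight _ (in_span_phi (enum_valP m))) sum_enum_val.
  under eq_bigr => i _ do rewrite ME scaler_sumr.
  rewrite exchange_big /=; apply: eq_bigr => i _; rewrite scaler_suml.
  by apply: eq_bigr => l _; rewrite scalerA -ME ipC.
have rkX : (\rank X <= 1)%N.
  have rkM : (d <= \rank Mx)%N.
    by have := mxrankM_maxr Lx Mx; rewrite LM mxrank1.
  by have := mulmx0_rank_max XM; move: rkM K_gt0; rewrite /d; lia.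
pose Y m n := A *+ (m == n) - ip (phi m) (phi n).
have minor m n p q : m \in K -> n \in K -> p \in K -> q \in K ->
    Y m n * Y p q = Y m q * Y p n.
  move=> mK nK pK qK.
  have YE u v (uK : u \in K) (vK : v \in K) :
      Y u v = X (enum_rank_in mK u) (enum_rank_in mK v).
    by rewrite !mxE !enum_rankK_in // -(inj_eq enum_val_inj) !enum_rankK_in.
  by rewrite !YE //; apply: mxrank_le1_minor.
have diagA m : m \in K -> S ^+ 2 + #|K|.-1%:R = A * S.
  move=> mK; rewrite -{2}(ip_diag m) -linearZl_LR -(tight _ (in_span_phi mK)).
  rewrite [RHS]ip_suml (bigD1 m) //= ip_diag -expr2; congr (_ + _).
  rewrite (eq_bigr (fun=> 1)); last first.
    by move=> n /andP[_ /ip_offdiag]; rewrite expr2.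
  rewrite sumr_const; congr (_%:R).
  rewrite (cardsD1 m K) mK /=; apply: eq_card => n.
  by rewrite !inE andbC.
have [m mK] : exists m, m \in K by apply/set0Pn.
have SA := diagA _ mK.
have K_gt1 : (1 < #|K|)%N.
  rewrite ltn_neqAle K_gt0 andbT eq_sym; apply/eqP => K1.
  suff phi0 : phi m = 0.
    by move: S_gt1; rewrite -(ip_diag m) phi0 linear0l ltr10.
  rewrite -(enum_rankK_in mK mK) ME big1 // => -[j jd] _; exfalso.
  by move: jd; rewrite /d K1.
have [n nK nm] : exists2 n, n \in K & n != m.
  have : (0 < #|K :\ m|)%N by move: K_gt1; rewrite (cardsD1 m K) mK.
  by rewrite card_gt0 => /set0Pn[n]; rewrite !inE => /andP[]; exists n.
(* The minor on [m], [n] gives (A - S)^2 = 1, and S (A - S) = #K - 1 > 0 selects the sign. *)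
have AS1 : A - S = 1.
  have := minor m m n n mK mK nK nK.
  rewrite /Y !eqxx (negPf nm) (eq_sym m) (negPf nm) !mulr1n !mulr0n !ip_diag.
  rewrite !sub0r (ipC (phi n)) mulrNN -!expr2 ip_offdiag 1?eq_sym // => sq1.
  have K1 : 0 < #|K|.-1%:R :> R by rewrite ltr0n -subn1 subn_gt0.
  have : 0 < A - S by nra.
  by nra.
split.
  rewrite -(prednK K_gt0) -natr1; have : #|K|.-1%:R = S by nra.
  by move=> ->.
move=> a b' c aK bK cK ab bc ac.
(* The diagonal entry of [Y] at [b'] is A - S = 1, so two sides of the triangle multiply to the
   third. *)
have := minor a b' b' c aK bK bK cK.
rewrite /Y eqxx (negPf ab) (negPf bc) (negPf ac) !mulr0n mulr1n !sub0r.
rewrite ip_diag AS1 mulr1 mulrNN => ->; rewrite mulNr -expr2.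
by rewrite ip_offdiag.
Qed.

(** For a suitable sign vector [e] the Gram matrix is #K I - e e^T, which is #K times the projection
    onto the complement of [e]. Hence the relations between the vectors are the multiples of [e]. *)
Lemma neg_triples_simplex (K : {set N}) :
  #|K|%:R = S + 1 -> neg_triples K -> regular_simplex ip phi K.
Proof.
move=> cardK neg.
have K_gt0 : (0 < #|K|)%N.
  by rewrite lt0n; apply/eqP => K0; move: cardK S_gt1; rewrite K0 => /eqP;
  rewrite eq_sym addr_eq0 => /eqP ->; lra.
have [n0 n0K] : exists n, n \in K by apply/set0Pn; rewrite -card_gt0.
(* Normalised by [e n0 = 1]; the triangle on [m], [n], [n0] then gives
   [ip (phi m) (phi n) = - (e m * e n)]. *)
pose e n := if n == n0 then 1 else - ip (phi n) (phi n0).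
have ee n : e n * e n = 1.
  rewrite /e; case: eqP => [_|/eqP n0n]; first by rewrite mulr1.
  by rewrite mulrNN -expr2 ip_offdiag.
have ipE m n : m \in K -> n \in K ->
    ip (phi m) (phi n) = #|K|%:R *+ (m == n) - e m * e n.
  move=> mK nK; have [->|mn] := eqVneq m n.
    by rewrite ip_diag ee cardK mulr1n; lra.
  rewrite mulr0n sub0r /e.
  have [m0|m0] := eqVneq m n0.
    by rewrite m0 eq_sym -m0 (negPf mn) mul1r opprK m0 ipC.
  have [n00|n00] := eqVneq n n0; first by rewrite n00 mulr1 opprK.
  have := neg m n n0 mK nK n0K mn n00 m0.
  have := ip_offdiag n00; have := ip_offdiag m0.
  set x := ip _ _; set y := ip _ _; set z := ip _ _ => x2 y2 xyz.
  have -> : z = z * y ^+ 2 * x ^+ 2 by rewrite x2 y2 !mulr1.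
  by rewrite mulrNN -[- (x * y)]mulN1r -xyz; ring.
have sum_ee : \sum_(n in K) e n * e n = #|K|%:R.
  by rewrite (eq_bigr (fun=> 1)) // sumr_const.
have ip_sum c m : m \in K ->
    ip (\sum_(n in K) c n *: phi n) (phi m) =
    #|K|%:R * c m - (\sum_(n in K) c n * e n) * e m.
  move=> mK; rewrite ip_suml.
  under eq_bigr => n nK do rewrite ipE // mulrBr mulrA.
  rewrite sumrB mulr_suml; congr (_ - _).
  rewrite (bigD1 m) //= eqxx mulr1n mulrC big1 ?addr0 // => n /andP[_ /negPf ->].
  by rewrite mulr0n mulr0.
have sum_e : \sum_(n in K) e n *: phi n = 0.
  apply: ip_eq0; rewrite ip_suml big1 // => m mK.
  by rewrite ipC ip_sum // sum_ee subrr mulr0.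
have K_neq0 : #|K|%:R != 0 :> R by rewrite pnatr_eq0 -lt0n.
split; first split.
- by rewrite -card_gt0.
- by exists S => [|n _]; [apply: lt_trans ltr01 S_gt1|apply: ip_diag].
- exists 1 => [|m n mK nK mn]; first by [].
  by rewrite -normrX ip_offdiag ?normr1.
- exists #|K|%:R; first by rewrite ltr0n.
  move=> y [c ->].
  transitivity (\sum_(n in K) (#|K|%:R * c n *: phi n)
      - (\sum_(n in K) c n * e n) *: \sum_(n in K) e n *: phi n); last first.
    rewrite sum_e scaler0 subr0 scaler_sumr.
    by apply: eq_bigr => n _; rewrite scalerA.
  rewrite scaler_sumr -sumrB; apply: eq_bigr => m mK.
  by rewrite ipC ip_sum // scalerBl !scalerA.
have dE : #|K|.-1 = #|K :\ n0| by rewrite (cardsD1 n0 K) n0K.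
(* The vectors other than [phi n0] form a basis: a relation among them, extended by 0 at [n0], is a
   multiple of [e], and [e n0 = 1] forces the factor to vanish. *)
rewrite dE; exists (fun i => phi (enum_val i)); split.
  move=> c c0.
  have [u uE] : exists u : N -> R, forall i, c i = u (enum_val i).
    case: (pickP (fun i : 'I_#|K :\ n0| => true)) => [i0 _|no]; last first.
      by exists (fun=> 0) => i; have := no i.
    exists (fun n => c (enum_rank_in (enum_valP i0) n)) => i.
    by rewrite enum_valK_in.
  pose v n := if n == n0 then 0 else u n.
  have v0 : \sum_(n in K) v n *: phi n = 0.
    rewrite (big_setD1 n0) //= /v eqxx scale0r add0r sum_enum_val -[RHS]c0.
    apply: eq_bigr => i _; rewrite uE.
    by have := enum_valP i; rewrite !inE => /andP[/negPf ->].
  have vE m : m \in K ->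
      #|K|%:R * v m = (\sum_(n in K) v n * e n) * e m.
    by move=> mK; apply/eqP; rewrite -subr_eq0 -ip_sum // v0 linear0l.
  move=> i; have := enum_valP i; rewrite !inE => /andP[/negPf in0 iK].
  have := vE _ iK; have := vE _ n0K; rewrite {1}/v /e eqxx mulr0 mulr1 => <-.
  rewrite mul0r /v in0 -uE => /eqP; rewrite mulf_eq0 (negPf K_neq0) /=.
  by move/eqP.
move=> y; split=> [[c ->]|[c ->]].
  exists (fun i => c (enum_val i) - c n0 * e (enum_val i)).
  have phi0 : phi n0 = - \sum_(n in K :\ n0) e n *: phi n.
    move/eqP: sum_e; rewrite (big_setD1 n0) //= {1}/e eqxx scale1r.
    by rewrite addr_eq0 => /eqP.
  rewrite (big_setD1 n0) //= phi0 scalerN scaler_sumr addrC -sumrB.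
  rewrite sum_enum_val; apply: eq_bigr => i _.
  by rewrite scalerBl scalerA.
rewrite -[X in in_span _ _ X]/(\sum_i _).
elim/big_rec: _ => [|i z _ [c' ->]].
  by exists (fun=> 0); rewrite big1 // => n _; rewrite scale0r.
exists (fun n => c i *+ (n == enum_val i) + c' n).
under [RHS]eq_bigr do rewrite scalerDl.
rewrite big_split /=; congr (_ + _).
have := enum_valP i; rewrite !inE => /andP[_ iK].
rewrite (bigD1 (enum_val i)) //= eqxx mulr1n big1 ?addr0 // => n /andP[_ /negPf ->].
by rewrite scale0r.
Qed.

End Simplices.

(** * Sums over subsets and a double count *)

Lemma sum_subset_card (T : finType) (W : {set T}) (F : nat -> int) :
  \sum_(A : {set T} | A \subset W) F #|A| =
  \sum_(j < #|W|.+1) 'C(#|W|, j)%:Z * F j.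
Proof.
rewrite (partition_big (fun A : {set T} => inord #|A| : 'I_#|W|.+1) xpredT) //=.
apply: eq_bigr => j _.
have jE (A : {set T}) : A \subset W -> (inord #|A| == j) = (#|A| == j).
  by move=> /subset_leq_card AW; rewrite -val_eqE /= inordK.
rewrite (eq_bigl [in [set A : {set T} | A \subset W & #|A| == j]]).
  rewrite (eq_bigr (fun=> F j)); last by move=> A; rewrite inE => /andP[_ /eqP ->].
  by rewrite sumr_const cards_draws -mulr_natl natz.
by move=> A; rewrite inE; case AW: (_ \subset _) => //=; rewrite jE.
Qed.

Lemma prod_subset (T : finType) (W : {set T}) (F : T -> int) :
  \prod_(u in W) (1 + F u) = \sum_(A : {set T} | A \subset W) \prod_(u in A) F u.
Proof.
rewrite big_mkcond /= (eq_bigr (fun u => (if u \in W then F u else 0) + 1)).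
  rewrite bigA_distr /= [RHS]big_mkcond; apply: eq_bigr => A _.
  case: ifPn => [/subsetP AW|/subsetPn[u uA uW]].
    rewrite [RHS]big_mkcond; apply: eq_bigr => u _.
    by case: ifP => // /AW ->.
  by rewrite (bigD1 u) //= uA (negPf uW) mul0r.
by move=> u _; case: ifP => _; rewrite ?add0r // addrC.
Qed.

(** Counts the pairs of a [W] in [F] and a new point that completes it to a member of [G]; each
    member of [G] arises from its [k] points other than the base point [w1]. *)
Lemma double_count (T : finType) (w1 : T) k e (F G : {set {set T}}) :
  (forall W, W \in F -> w1 \in W) ->
  (forall W, W \in G -> w1 \in W /\ #|W| = k.+1) ->
  (forall W w, W \in G -> w \in W -> w != w1 -> W :\ w \in F) ->
  (forall W, W \in F -> #|[set w | w \notin W & w |: W \in G]| = e) ->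
  (#|G| * k = #|F| * e)%N.
Proof.
move=> Fw1 Gw1 GF Fe.
have <- : (\sum_(W in F) \sum_(w | (w \notin W) && (w |: W \in G)) 1 = #|F| * e)%N.
  rewrite -sum_nat_const; apply: eq_bigr => W WF.
  by rewrite -(Fe W WF) sum1dep_card.
have <- : (\sum_(W in G) \sum_(w | (w \in W) && (w != w1)) 1 = #|G| * k)%N.
  rewrite -sum_nat_const; apply: eq_bigr => W WG.
  have [w1W cardW] := Gw1 W WG.
  rewrite sum1dep_card; move: cardW; rewrite (cardsD1 w1) w1W => -[<-].
  by apply: eq_card => w; rewrite !inE andbC.
rewrite !pair_big_dep /=.
rewrite (reindex_onto (fun p => (p.2 |: p.1, p.2)) (fun p => (p.1 :\ p.2, p.2))).
  apply: eq_bigl => -[W w] /=; apply/andP/andP => [[]|[]].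
    rewrite setU11 /= => /andP[WG ww1] /eqP[WE].
    have wW : w \notin W by rewrite -WE !inE eqxx.
    by rewrite wW WG; split=> //; rewrite -WE; apply: GF; rewrite ?setU11.
  move=> WF /andP[wW WG]; rewrite WG setU11 setU1K // eqxx; split=> //=.
  by apply: contraNneq wW => ->; apply: Fw1.
by move=> -[W w] /= /andP[_ /andP[wW _]]; rewrite setD1K.
Qed.

(** * Cliques of singular vectors and their extensions *)

Section QuadraticForm.

Variables (T : finZmodType) (b : T -> T -> bool) (q : T -> bool) (J : nat).
Hypothesis addxx : forall x : T, x + x = 0.
Hypothesis bDl : forall x y z, b (x + y) z = b x z (+) b y z.
Hypothesis bxx : forall x, b x x = false.
Hypothesis bC : forall x y, b x y = b y x.
Hypothesis b_nondeg : forall u, u != 0 -> exists w, b w u.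
Hypothesis qD : forall x y, q (x + y) = q x (+) q y (+) b x y.

Implicit Types W A : {set T}.

Definition clique (W : {set T}) :=
  [forall u in W, ~~ q u] && [forall u in W, forall v in W, (u != v) ==> b u v].

Lemma cliqueP (W : {set T}) : reflect ({in W, forall u, q u = false} /\
  {in W &, forall u v, u != v -> b u v}) (clique W).
Proof.
apply: (iffP andP) => -[h1 h2]; split.
- by move=> u uW; apply: negbTE; move/forall_inP: h1; apply.
- by move=> u v uW vW; move/forall_inP/(_ u uW)/forall_inP/(_ v vW)/implyP: h2.
- by apply/forall_inP => u uW; rewrite h1.
- by apply/forall_inP => u uW; apply/forall_inP => v vW; apply/implyP/h2.
Qed.

Lemma cliqueS (W W' : {set T}) : W' \subset W -> clique W -> clique W'.
Proof.
move=> /subsetP sW /cliqueP[h1 h2]; apply/cliqueP; split=> [u /sW /h1 //|].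
by move=> u v /sW uW /sW vW; apply: h2.
Qed.

Notation Sum A := (\sum_(u in (A : {set T})) u).

Lemma oppE (x : T) : - x = x.
Proof. by apply/eqP; rewrite eq_sym -addr_eq0 addxx. Qed.

Lemma b_sum (A : {set T}) w : b (Sum A) w = odd #|[set u in A | b u w]|.
Proof.
have b0 : b 0 w = false by rewrite -(addxx 0) bDl addbb.
rewrite (big_morph (fun u => b u w) (fun x y => bDl x y w) b0).
rewrite cardsE -sum1_card (big_morph odd oddD (erefl : odd 0 = false)) /=.
rewrite big_mkcondr; apply: eq_bigr => u uA /=.
by case: (b u w).
Qed.

(** Each member of [A] other than [w] contributes 1, and [w] itself contributes 0. *)
Lemma b_sum_clique W (A : {set T}) w :
  clique W -> A \subset W -> w \in W -> b (Sum A) w = odd #|A| (+) (w \in A).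
Proof.
move=> /cliqueP[_ bW] /subsetP AW wW.
rewrite b_sum (cardsD1 w A) oddD addbAC oddb addbb /=; congr (odd _).
apply: eq_card => u; rewrite !inE andbC.
have [->|uw] := eqVneq u w; first by rewrite bxx.
by case uA: (u \in A); rewrite ?andbF // bW // AW.
Qed.

(** Since the members are singular, expanding [q] at the sum leaves one unit for each pair. *)
Lemma q_sum_clique W : clique W -> q (Sum W) = odd 'C(#|W|, 2).
Proof.
have [n] := ubnP #|W|; elim: n W => // n IHn W; rewrite ltnS => leWn cW.
have [->|/set0Pn[w wW]] := eqVneq W set0.
  by rewrite big_set0 cards0 bin0n -(addxx 0) qD addbb -{1}(addxx 0) bDl addbb.
have sW : W :\ w \subset W by apply: subsetDl.
have cW' := cliqueS sW cW.
have /cliqueP[qW _] := cW.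
rewrite (big_setD1 w) //= qD qW // IHn //; last first.
  by move: leWn; rewrite (cardsD1 w) wW.
rewrite bC (b_sum_clique cW) // !inE eqxx addbF (cardsD1 w W) wW add1n.
by rewrite binS bin1 oddD.
Qed.

(* On W, the function [b (Sum A)] is the indicator of A up to a constant, so it
   determines A up to complementation. *)
Lemma sum_clique_inj W (A A' : {set T}) :
  clique W -> A \subset W -> A' \subset W -> Sum A = Sum A' ->
  A = A' \/ (A' = W :\: A /\ odd #|W|).
Proof.
move=> cW AW A'W sumE.
have bE w : w \in W -> odd #|A| (+) (w \in A) = odd #|A'| (+) (w \in A').
  by move=> wW; rewrite -!(b_sum_clique cW) // sumE.
case: (boolP (odd #|A| == odd #|A'|)) => [/eqP odE|odN].
  left; apply/setP => w; case wW: (w \in W).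
    by move: (bE w wW); rewrite odE => /addbI.
  by rewrite (contraFF (subsetP AW w)) // (contraFF (subsetP A'W w)).
have A'E : A' = W :\: A.
  apply/setP => w; rewrite !inE; case wW: (w \in W).
    move: (bE w wW) odN; rewrite andbT.
    by case: (odd #|A|); case: (odd #|A'|); case: (w \in A); case: (w \in A').
  by rewrite (contraFF (subsetP A'W w)) // andbF.
right; split=> //; rewrite -(cardsID A W) (setIidPr AW) -A'E oddD.
by move: odN; case: (odd _); case: (odd _).
Qed.

(** Compared with the empty set in [sum_clique_inj], a nonempty subset of sum 0 can only be all of
    [W], with #W odd. *)
Lemma sum_clique_neq0 W (A : {set T}) :
  clique W -> A \subset W -> A != set0 -> (odd #|W| -> Sum W != 0) ->
  Sum A != 0.
Proof.
move=> cW AW A0 Wfree; apply/eqP => sumA0.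
have [|A0'|[A0' oW]] := sum_clique_inj cW AW (sub0set W).
- by rewrite big_set0.
- by rewrite A0' eqxx in A0.
have AE : A = W.
  by apply/eqP; rewrite eqEsubset AW -setD_eq0 -A0' /=.
by move: (Wfree oW); rewrite -AE sumA0 eqxx.
Qed.

Lemma clique_bound W : clique W -> ~~ odd #|W| -> (2 ^ #|W| <= #|T|)%N.
Proof.
move=> cW eW; rewrite -card_powerset.
rewrite -(card_in_imset (f := fun A : {set T} => Sum A)) ?max_card // => A A'.
rewrite !inE => AW A'W sumE.
by have [//|[_]] := sum_clique_inj cW AW A'W sumE; rewrite (negPf eW).
Qed.

Local Notation sg c := ((-1) ^+ nat_of_bool c : int).

(** Orthogonality of characters: translation by [w0] with [b w0 u] negates the sum. *)
Lemma sum_sg_b u : \sum_w sg (b w u) = #|T|%:Z *+ (u == 0).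
Proof.
have [->|/b_nondeg[w0 bw0]] := eqVneq u 0.
  rewrite (eq_bigr (fun=> 1)) ?sumr_const ?natz //.
  by move=> w _; rewrite bC -(addxx 0) bDl addbb.
have : \sum_w sg (b w u) = - \sum_w sg (b w u).
  rewrite {1}(reindex_inj (addrI w0)) -sumrN; apply: eq_bigr => w _.
  by rewrite bDl signr_addb bw0 mulN1r.
by rewrite mulr0n; lia.
Qed.

Hypothesis q_sum : \sum_w sg (q w) = 2 ^+ J.

(** Completing the square: [q w (+) b w u = q (u + w) (+) q u]. *)
Lemma sum_sg_qb u : \sum_w sg (q w) * sg (b w u) = 2 ^+ J * sg (q u).
Proof.
rewrite -q_sum mulr_suml (reindex_inj (addrI u)).
apply: eq_bigr => w _; rewrite -!signr_addb; congr (_ ^+ _).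
rewrite qD bDl bxx addFb (bC u w).
by case: (q u); case: (q w); case: (b w u).
Qed.

Definition ext (W : {set T}) := [set w | ~~ q w & [forall u in W, b w u]].

(** A [j]-subset of a [k]-clique contributes (-1)^j from the expanded product in [card_ext] and
    (-1)^C(j,2) from the value of [q] at its sum. *)
Definition sign_sum k := \sum_(j < k.+1) 'C(k, j)%:Z * (-1) ^+ (j + 'C(j, 2)).

(** The product of [1 + sg (q w)] and all [1 - sg (b w u)] is 2^(#W + 1) on [ext W] and 0 elsewhere.
    Expanded over the subsets [A] of [W], it becomes character sums at [Sum A], which is nonzero
    unless [A] is empty. *)
Lemma card_ext (W : {set T}) : clique W -> (odd #|W| -> Sum W != 0) ->
  #|ext W|%:Z * 2 ^+ #|W|.+1 = #|T|%:Z + 2 ^+ J * sign_sum #|W|.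
Proof.
move=> cW Wfree.
transitivity (\sum_w (1 + sg (q w)) * \prod_(u in W) (1 + - sg (b w u))).
  rewrite -natz -sumr_const mulr_suml big_mkcond /=; apply: eq_bigr => w _.
  rewrite inE; case: (q w) => /=; first by rewrite subrr mul0r.
  case: ifPn => [/forall_inP bw|/forall_inPn[u uW /negPf bu]]; last first.
    by rewrite [in RHS](bigD1 u) //= bu subrr mul0r mulr0.
  rewrite mul1r exprS -prodr_const; congr (_ * _).
  by apply: eq_bigr => u /bw ->.
under eq_bigr => w _ do rewrite prod_subset mulr_sumr.
rewrite exchange_big /=.
transitivity (\sum_(A : {set T} | A \subset W)
   (#|T|%:Z *+ (A == set0) + 2 ^+ J * (-1) ^+ (#|A| + 'C(#|A|, 2)))).
  apply: eq_bigr => A AW.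
  have sgE w : \prod_(u in A) - sg (b w u) = (-1) ^+ #|A| * sg (b w (Sum A)).
    rewrite prodrN; congr (_ * _); rewrite bC b_sum signr_odd cardsE -sum1_card.
    rewrite big_mkcondr /= -prodrXr; apply: eq_bigr => u _.
    by rewrite bC; case: (b u w).
  under eq_bigr => w _ do rewrite sgE mulrCA mulrDl mul1r.
  rewrite -mulr_sumr big_split /= sum_sg_b sum_sg_qb.
  rewrite (q_sum_clique (cliqueS AW cW)) signr_odd mulrDr; congr (_ + _).
    have [->|A0] := eqVneq A set0.
      by rewrite cards0 mul1r big_set0 eqxx.
    by rewrite (negPf (sum_clique_neq0 cW AW A0 Wfree)) !mulr0n mulr0.
  by rewrite mulrCA exprD.
rewrite big_split /= (bigD1 set0) ?sub0set //= eqxx mulr1n.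
rewrite big1 ?addr0; last by move=> A /andP[_ /negPf ->].
by rewrite -mulr_sumr (sum_subset_card W (fun j => (-1) ^+ (j + 'C(j, 2)))).
Qed.

Lemma mem_ext (W : {set T}) w :
  clique W -> w \in ext W -> w \notin W /\ clique (w |: W).
Proof.
move=> /cliqueP[qW bW]; rewrite inE => /andP[/negPf qw /forall_inP bw].
split; first by apply/negP => /bw; rewrite bxx.
apply/cliqueP; split=> [u|u v]; rewrite !inE.
  by case/predU1P => [->//|/qW].
case/predU1P => [->|uW] /predU1P[->|vW]; first by rewrite eqxx.
- by move=> _; apply: bw.
- by move=> _; rewrite bC; apply: bw.
by apply: bW.
Qed.

Lemma extP (W : {set T}) w : w \notin W -> clique (w |: W) -> w \in ext W.
Proof.
move=> wW /cliqueP[qW bW]; rewrite inE qW ?setU11 //=.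
apply/forall_inP => u uW; apply: bW; rewrite ?setU11 ?inE ?uW ?orbT //.
by apply: contraNneq wW => ->.
Qed.

Variable w1 : T.
Hypotheses (w1_neq0 : w1 != 0) (q_w1 : q w1 = false).

Definition cliques k := [set W : {set T} | [&& clique W, w1 \in W & #|W| == k]].
(** By [sum_clique_neq0], a nonzero total already makes the members linearly independent. *)
Definition free_cliques k := [set W in cliques k | Sum W != 0].



Lemma card_free_cliques1 : #|free_cliques 1| = 1%N.
Proof.
rewrite -(cards1 [set w1]); apply: eq_card => W; rewrite !inE.
apply/andP/eqP => [[/and3P[_ w1W /cards1P[w WE]] _]|->].
  by move: w1W; rewrite WE inE => /eqP ->.
rewrite big_set1 w1_neq0 set11 cards1 eqxx; split=> //; rewrite !andbT.
by apply/cliqueP; split=> [u|u v] /set1P -> // /set1P ->; rewrite eqxx.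
Qed.

(** Any linear relation in a clique involves all its members, so a proper subset is independent even
    when the clique is not. *)
Lemma cliques_del k W w :
  W \in cliques k.+1 -> w \in W -> w != w1 -> W :\ w \in free_cliques k.
Proof.
rewrite !inE => /and3P[cW w1W cardW] wW ww1.
have sW : W :\ w \subset W by apply: subsetDl.
have W'0 : W :\ w != set0 by apply/set0Pn; exists w1; rewrite !inE eq_sym ww1.
have cardW' : #|W| = #|W :\ w|.+1 by rewrite (cardsD1 w) wW.
rewrite (cliqueS sW cW) w1W eq_sym ww1 -eqSS -cardW' cardW /=.
have [oW|eW] := boolP (odd #|W|).
  apply: (sum_clique_neq0 (cliqueS sW cW) (subxx _) W'0).
  by move: oW; rewrite cardW' /= => /negPf ->.
by apply: (sum_clique_neq0 cW sW W'0); rewrite (negPf eW).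
Qed.

Lemma ext_cliques k W w : W \in cliques k ->
  (w \in ext W) = (w \notin W) && (w |: W \in cliques k.+1).
Proof.
rewrite inE => /and3P[cW w1W /eqP cardW].
apply/idP/andP => [wE|[wW]]; last first.
  by rewrite inE => /and3P[cwW _ _]; apply: extP.
have [wW cwW] := mem_ext cW wE; split=> //.
by rewrite inE cwW !inE w1W orbT cardsU1 wW cardW /=.
Qed.

(* The only extension of W with sum 0 is by [Sum W], which is in [ext W] iff
   k and 'C(k, 2) are even. *)
Lemma free_cliques_step k e :
  (e + (~~ odd 'C(k, 2) && ~~ odd k))%:Z * 2 ^+ k.+1 =
    #|T|%:Z + 2 ^+ J * sign_sum k ->
  (#|free_cliques k.+1| * k = #|free_cliques k| * e)%N.
Proof.
move=> eE; apply: (@double_count _ w1) => [W|W|W w|W].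
- by rewrite !inE => /andP[/and3P[]].
- by rewrite !inE => /andP[/and3P[_ -> /eqP]].
- by rewrite inE => /andP[WC _]; apply: cliques_del.
rewrite inE => /andP[WC Wfree].
have := WC; rewrite inE => /and3P[cW w1W /eqP cardW].
transitivity #|ext W :\ Sum W|.
  apply: eq_card => w; rewrite in_setD1 (ext_cliques w WC) in_set.
  rewrite [w |: W \in free_cliques _]in_set.
  case: (boolP (w \in W)) => wW; first by rewrite andbF.
  by rewrite big_setU1 //= addr_eq0 oppE andbC.
have sumE : (Sum W \in ext W) = ~~ odd 'C(k, 2) && ~~ odd k.
  rewrite inE q_sum_clique // cardW; congr (_ && _).
  apply/forall_inP/idP => [/(_ _ w1W)|ok u uW];
    rewrite (b_sum_clique cW (subxx W)) ?cardW // ?w1W ?uW addbT //.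
have : #|ext W|%:Z * 2 ^+ k.+1 = (e + (Sum W \in ext W))%:Z * 2 ^+ k.+1.
  by rewrite sumE eE -cardW card_ext.
move=> /(mulIf (expf_neq0 k.+1 (isT : 2 != 0 :> int))) [].
by rewrite (cardsD1 (Sum W)) addnC => /addIn.
Qed.

(** At the final size dependent cliques are counted too, so the extension by [Sum W] is not
    subtracted. *)
Lemma cliques_last k e :
  e%:Z * 2 ^+ k.+1 = #|T|%:Z + 2 ^+ J * sign_sum k ->
  (#|cliques k.+1| * k = #|free_cliques k| * e)%N.
Proof.
move=> eE; apply: (@double_count _ w1) => [W|W|W w WC|W].
- by rewrite !inE => /andP[/and3P[]].
- by rewrite inE => /and3P[_ -> /eqP].
- exact: cliques_del.
rewrite inE => /andP[WC Wfree].
have := WC; rewrite inE => /and3P[cW w1W /eqP cardW].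
transitivity #|ext W|.
  by apply: eq_card => w; rewrite (ext_cliques w WC) in_set.
have : #|ext W|%:Z * 2 ^+ k.+1 = e%:Z * 2 ^+ k.+1.
  by rewrite eE -cardW card_ext.
by move=> /(mulIf (expf_neq0 k.+1 (isT : 2 != 0 :> int))) [].
Qed.

End QuadraticForm.

(** * Numbers of cliques for J = 2, 3, 4 *)

Lemma sign_sum_values :
  (sign_sum 1 = 0) * (sign_sum 2 = -2) * (sign_sum 3 = -4) * (sign_sum 4 = -4)
  * (sign_sum 5 = 0)
  * (sign_sum 6 = 8) * (sign_sum 7 = 16) * (sign_sum 8 = 16).
Proof. by rewrite /sign_sum !big_ord_recl !big_ord0. Qed.

Section Count.

Variables (T : finZmodType) (b : T -> T -> bool) (q : T -> bool) (J : nat).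
Hypothesis addxx : forall x : T, x + x = 0.
Hypothesis bDl : forall x y z, b (x + y) z = b x z (+) b y z.
Hypothesis bxx : forall x, b x x = false.
Hypothesis bC : forall x y, b x y = b y x.
Hypothesis b_nondeg : forall u, u != 0 -> exists w, b w u.
Hypothesis qD : forall x y, q (x + y) = q x (+) q y (+) b x y.
Hypothesis q_sum : \sum_w (-1) ^+ nat_of_bool (q w) = 2 ^+ J :> int.
Hypothesis cardT : #|T| = (2 ^ (2 * J))%N.
Variable w1 : T.
Hypotheses (w1_neq0 : w1 != 0) (q_w1 : q w1 = false).

(** The chain starts at the single clique consisting of [w1] and grows one point at a time. The list
    is indexed by [J]; its entries at 0 and 1 are fillers. *)
Lemma card_cliques : (2 <= J <= 4)%N ->
  #|cliques b q w1 (2 ^ J.-1).+1| = nth 0%N [:: 0; 0; 2; 8; 64]%N J.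
Proof.
have step k e :=
  @free_cliques_step _ _ _ _ addxx bDl bxx bC b_nondeg qD q_sum w1 k e.
have last k e :=
  @cliques_last _ _ _ _ addxx bDl bxx bC b_nondeg qD q_sum w1 k e.
have c1 := card_free_cliques1 b w1_neq0 q_w1.
move: step last; rewrite cardT.
case: J => [|[|[|[|[|//]]]]] // step last _.
(* The second argument of [step] and [last] is (2^(2J) + 2^J [sign_sum k]) / 2^(k+1), up to the
   correction for extensions of sum 0. *)
- suff : #|cliques b q w1 3%N| = 2%N by [].
  have := step 1%N 4%N; have := last 2%N 1%N; rewrite !sign_sum_values c1.
  by move=> /(_ erefl) h /(_ erefl) h0; lia.
- suff : #|cliques b q w1 5%N| = 8%N by [].
  have := step 1%N 16%N; have := step 2%N 6%N; have := step 3%N 2%N.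
  have := last 4%N 1%N.
  rewrite !sign_sum_values c1.
  by move=> /(_ erefl) h3 /(_ erefl) h2 /(_ erefl) h1 /(_ erefl) h0; lia.
suff : #|cliques b q w1 9%N| = 64%N by [].
have := step 1%N 64%N; have := step 2%N 28%N; have := step 3%N 12%N.
(* Six extensions, less the one of sum 0. *)
have := step 4%N 5%N.
have := step 5%N 4%N; have := step 6%N 3%N; have := step 7%N 2%N.
have := last 8%N 1%N.
rewrite !sign_sum_values c1.
move=> /(_ erefl) h7 /(_ erefl) h6 /(_ erefl) h5 /(_ erefl) h4.
by move=> /(_ erefl) h3 /(_ erefl) h2 /(_ erefl) h1 /(_ erefl) h0; lia.
Qed.

End Count.

(** * Counting in block designs *)

Section Design.

Variables (N : finType) (bs : {set {set N}}) (k L : nat).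
Hypothesis card_block : forall X, X \in bs -> #|X| = k.
Hypothesis pair_count : forall x y,
  x != y -> #|[set X in bs | (x \in X) && (y \in X)]| = L.

Lemma count_enum_set (P : pred {set N}) :
  count P (enum bs) = #|[set X in bs | P X]|.
Proof.
rewrite -size_filter cardE /enum_mem -filter_predI; congr size.
by apply: eq_filter => X; rewrite /= !inE andbC.
Qed.

(** Exchanges the order of summation over blocks through [x] and points of [Y]. The whole vertex set
    as [Y] gives the replication number; an even set as [Y] gives the oval property. *)
Lemma sum_block_meet x (Y : {set N}) :
  (\sum_(X in bs | x \in X) #|(X :&: Y) :\ x| = #|Y :\ x| * L)%N.
Proof.
under eq_bigr => X _ do rewrite -sum1_card big_mkcond /=.
rewrite exchange_big /= -sum_nat_const [RHS]big_mkcond /=.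
apply: eq_bigr => y _; rewrite !inE; have [->|yx] /= := eqVneq y x.
  by rewrite big1 // => X; rewrite !inE eqxx.
case yY: (y \in Y); last by rewrite big1 // => X _; rewrite !inE yY !andbF.
rewrite -(@pair_count x y) 1?eq_sym // -big_mkcondr /= sum1dep_card.
by apply: eq_card => X; rewrite !inE yx yY andbT -andbA.
Qed.

Lemma point_count x :
  (#|[set X in bs | x \in X]| * k.-1 = #|N|.-1 * L)%N.
Proof.
have -> : #|N|.-1 = #|[set: N] :\ x| by rewrite -cardsT (cardsD1 x) inE.
rewrite -sum_block_meet -sum_nat_const; apply: eq_big => [X|X].
  by rewrite !inE.
rewrite inE => /andP[/card_block <- xX].
by rewrite setIT (cardsD1 x) xX.
Qed.

Lemma block_count r : (forall x, #|[set X in bs | x \in X]| = r) ->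
  (#|bs| * k = #|N| * r)%N.
Proof.
move=> rE; rewrite -sum_nat_const -sum_nat_const.
transitivity (\sum_(X in bs) \sum_x (x \in X))%N.
  by apply: eq_bigr => X /card_block <-; rewrite -sum1_card big_mkcond.
rewrite exchange_big; apply: eq_bigr => x _.
rewrite -(rE x) -sum1_card [RHS](eq_bigl [pred X in bs | x \in X]).
  by rewrite big_mkcondr.
by move=> X; rewrite !inE.
Qed.

Lemma BIBD_of_counts V K r b :
  #|N| = V -> k = K -> (1 < K)%N -> (V.-1 * L = r * K.-1)%N ->
  (V * r = b * K)%N -> (0 < b)%N -> forms_BIBD bs V K L r b.
Proof.
move=> cardN kE K_gt1 rE bE b_gt0.
have K1 : (0 < K.-1)%N by rewrite -subn1 subn_gt0.
have rx x : #|[set X in bs | x \in X]| = r.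
  by have /eqP := point_count x; rewrite kE cardN rE eqn_pmul2r // => /eqP.
split=> //.
- split=> //; rewrite -cardE; have /eqP := block_count rx.
  by rewrite kE cardN bE eqn_pmul2r 1?ltnW // => /eqP.
- by split=> // X; rewrite mem_enum => /card_block ->.
- by move=> x y xy; rewrite count_enum_set pair_count.
- by move=> x; rewrite count_enum_set.
Qed.

(* The blocks through [x] meet [Y] in (#|Y| - 1) L = r further points in all,
   and in at most one each. *)
Lemma meet_two (Y : {set N}) X x :
  (forall X, X \in bs -> #|X :&: Y| <= 2)%N ->
  (#|Y|.-1 * k.-1 = #|N|.-1)%N -> (1 < k)%N ->
  X \in bs -> x \in X -> x \in Y -> #|X :&: Y| = 2.
Proof.
move=> le2 cardY k_gt1 Xbs xX xY.
have k1 : (0 < k.-1)%N by rewrite -subn1 subn_gt0.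
have cardYx : #|Y :\ x| = #|Y|.-1 by rewrite (cardsD1 x Y) xY.
have le1 Z : (Z \in bs) && (x \in Z) -> (#|(Z :&: Y) :\ x| <= 1)%N.
  by move=> /andP[/le2 + xZ]; rewrite (cardsD1 x) inE xZ xY.
have sumE : (\sum_(Z in bs | x \in Z) #|(Z :&: Y) :\ x| =
             \sum_(Z in bs | x \in Z) 1)%N.
  rewrite sum_block_meet sum1dep_card cardYx; apply/eqP.
  by rewrite -(eqn_pmul2r k1) point_count -cardY mulnAC.
have := leqif_sum (fun Z bZ => leqif_eq (le1 Z bZ)).
move=> [_]; rewrite sumE eqxx => /esym/forall_inP/(_ X).
rewrite Xbs xX => /(_ isT) /eqP X1.
by rewrite (cardsD1 x) inE xX xY X1.
Qed.

End Design.

(** * Odd and even sets in an affine quadric *)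

Lemma double_lt_exp n : (4 < n)%N -> (2 * n < 2 ^ n.-1)%N.
Proof.
elim: n => // n IHn; rewrite ltnS leq_eqVlt => /predU1P[<- //|n_gt4] /=.
rewrite -[n in (2 ^ n)%N]prednK ?expnS; last exact: leq_trans n_gt4.
by have := IHn n_gt4; lia.
Qed.

Section AffineQuadric.

Variables (T : finZmodType) (b : T -> T -> bool) (p : T -> bool) (J : nat).
Variable D : {set T}.
Hypothesis addxx : forall x : T, x + x = 0.
Hypothesis bDl : forall x y z, b (x + y) z = b x z (+) b y z.
Hypothesis bxx : forall x, b x x = false.
Hypothesis bC : forall x y, b x y = b y x.
Hypothesis b_nondeg : forall u, u != 0 -> exists w, b w u.
Hypothesis pD : forall x y, p (x + y) = p x (+) p y (+) p 0 (+) b x y.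
Hypothesis J_gt1 : (1 < J)%N.
Hypothesis cardT : #|T| = (2 ^ (2 * J))%N.
Hypothesis memD : forall x, (x \in D) = ~~ p x.
Hypothesis cardD : #|D| = (2 ^ J.-1 * (2 ^ J + 1))%N.

Local Notation N := {v | v \in D}.
Implicit Types K : {set N}.
Local Notation sg c := ((-1) ^+ nat_of_bool c : int).

Lemma b0 x : b 0 x = false.
Proof. by rewrite -(addxx 0) bDl addbb. Qed.

Lemma bDr x y z : b x (y + z) = b x y (+) b x z.
Proof. by rewrite bC bDl !(bC x). Qed.

Lemma p_val (x : N) : p (val x) = false.
Proof. by apply: negbTE; rewrite -memD (valP x). Qed.

(** As [p] is false exactly on [D], the sum is 2 #D - #T. *)
Lemma p_sum : \sum_w sg (p w) = 2 ^+ J.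
Proof.
rewrite (bigID (mem D)) /= (eq_bigr (fun=> 1)); last first.
  by move=> w; rewrite memD => /negPf ->.
rewrite addrC (eq_bigr (fun=> -1)) /=; last by move=> w; rewrite memD negbK => ->.
have J2 : (2 ^ J = 2 * 2 ^ J.-1)%N by rewrite -expnS prednK // ltnW.
have := cardC (mem D); rewrite !sumr_const mulNrn cardT mul2n -addnn expnD.
have -> : 2 ^+ J = (2 ^ J)%N%:Z by rewrite -natz natrX.
rewrite cardD J2; move: (2 ^ J.-1)%N #|_| => m c h; rewrite !natz; nia.
Qed.

(** Moving the origin to a point of [D] turns the affine [p] into a genuine quadratic form, whose
    singular vectors are the translate of [D]. *)
Definition shift (x : N) w := p (val x + w).

Lemma shiftD x u v : shift x (u + v) = shift x u (+) shift x v (+) b u v.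
Proof.
rewrite /shift addrA (pD (val x + u)) bDl (pD (val x) v) p_val.
by case: (p _); case: (p v); case: (p 0); case: (b _ v); case: (b u v).
Qed.

Lemma shift_sum x : \sum_w sg (shift x w) = 2 ^+ J.
Proof. by rewrite -p_sum [RHS](reindex_inj (addrI (val x))). Qed.

Definition triple (x y z : N) :=
  b (val x) (val y) (+) b (val y) (val z) (+) b (val x) (val z).

(** Each cross term with [val v] occurs twice and cancels. *)
Lemma triple_shift (v x y z : N) : triple x y z =
  b (val v + val x) (val v + val y) (+) b (val v + val y) (val v + val z)
  (+) b (val v + val x) (val v + val z).
Proof.
rewrite /triple !bDl !bDr !bxx (bC _ (val v)) (bC (val y) (val v)).
by case: (b (val v) (val x)); case: (b (val v) (val y));
   case: (b (val v) (val z)); case: (b (val x) (val y));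
   case: (b (val x) (val z)); case: (b (val y) (val z)).
Qed.

Definition all_triples c (K : {set N}) := [forall x in K, forall y in K,
  forall z in K, [&& x != y, y != z & x != z] ==> (triple x y z == c)].

Lemma all_triplesP c (K : {set N}) : reflect
  (forall x y z, x \in K -> y \in K -> z \in K ->
     x != y -> y != z -> x != z -> triple x y z = c) (all_triples c K).
Proof.
apply: (iffP forall_inP) => [H x y z xK yK zK xy yz xz|H x xK].
  move/forall_inP/(_ y yK)/forall_inP/(_ z zK): (H x xK).
  by rewrite xy yz xz => /eqP.
apply/forall_inP => y yK; apply/forall_inP => z zK.
by apply/implyP => /and3P[*]; rewrite H.
Qed.

Definition odd_sets := [set K : {set N} |
  (#|K| == (2 ^ J.-1).+2) && all_triples true K].
Definition even_sets := [set K : {set N} |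
  (#|K| == 2 ^ J)%N && all_triples false K].

Definition star (x : N) (K : {set N}) := [set val x + val v | v in K :\ x].

Lemma shift_val_inj (x : N) : injective (fun v : N => val x + val v).
Proof. by move=> u v /addrI /val_inj. Qed.

Lemma card_star (x : N) K : x \in K -> #|K| = #|star x K|.+1.
Proof.
move=> xK; rewrite card_imset ?(cardsD1 x K) ?xK //.
exact: shift_val_inj.
Qed.

(** With [x] moved to the origin, the triple [x], [y], [z] reduces to the single value
    [b (val x + val y) (val x + val z)]. *)
Lemma star_clique (x : N) K :
  x \in K -> all_triples true K -> clique b (shift x) (star x K).
Proof.
move=> xK /all_triplesP K3; apply/cliqueP; split=> [u|u v].
  by move=> /imsetP[v _ ->]; rewrite /shift addrA addxx add0r p_val.
move=> /imsetP[y + ->] /imsetP[z + ->]; rewrite !inE => /andP[yx yK] /andP[zx zK].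
rewrite (inj_eq (@shift_val_inj x)) => yz.
have := K3 x y z xK yK zK; rewrite eq_sym yx yz eq_sym zx.
move=> /(_ isT isT isT); rewrite (triple_shift x) addxx.
by rewrite !b0 addFb addbF.
Qed.

Lemma odd_sets_eq0 : (4 < J)%N -> odd_sets = set0.
Proof.
move=> J_gt4; apply/setP => K; rewrite !inE; apply/negP => /andP[/eqP cardK K3].
have [x xK] : exists x, x \in K by apply/set0Pn; rewrite -card_gt0 cardK.
have cK := star_clique xK K3.
have := card_star xK; rewrite cardK => -[cardS].
(* The star has the odd size 2^(J-1) + 1; one point is dropped because [clique_bound] needs an even
   size. *)
have [w wS] : exists w, w \in star x K.
  by apply/set0Pn; rewrite -card_gt0 -cardS.
have cardS' : #|star x K :\ w| = (2 ^ J.-1)%N.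
  by move: cardS; rewrite (cardsD1 w (star x K)) wS => -[].
have cS' := cliqueS (subsetDl _ [set w]) cK.
have := clique_bound addxx bDl bxx cS'; rewrite cardS' cardT.
rewrite oddX orbF -subn1 subn_eq0 -ltnNge J_gt1 => /(_ isT).
rewrite leq_exp2l // leqNgt => /negP; apply.
by rewrite subn1; apply: double_lt_exp.
Qed.

(** [star x] is a bijection between the two families; [y] corresponds to the base vector
    [val x + val y]. *)
Lemma odd_sets_pair (x y : N) : x != y ->
  #|[set K in odd_sets | (x \in K) && (y \in K)]| =
  #|cliques b (shift x) (val x + val y) (2 ^ J.-1).+1|.
Proof.
move=> xy.
rewrite -(card_in_imset (f := star x)); last first.
  move=> K K'; rewrite !inE => /and3P[_ xK _] /and3P[_ xK' _].
  move=> /(imset_inj (@shift_val_inj x)) KE.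
  by rewrite -(setD1K xK) KE setD1K.
apply: eq_card => W; rewrite inE; apply/imsetP/and3P.
  move=> [K + ->]; rewrite !inE => /and3P[/andP[/eqP cardK K3] xK yK].
  rewrite star_clique // -eqSS -card_star // cardK; split=> //.
  by apply/imsetP; exists y; rewrite // !inE eq_sym xy.
(* Translating back stays in [D] because members of [W] are singular for [shift x]. *)
move=> [cW wW /eqP cardW]; pose K' := [set v : N | val x + val v \in W].
have [qW bW] := cliqueP _ _ _ cW.
have xK' : x \notin K'.
  rewrite inE addxx; apply/negP => W0.
  have xy0 : 0 != val x + val y.
    by rewrite -(addxx (val x)) (inj_eq (addrI _)) (inj_eq val_inj).
  by have := bW _ _ W0 wW xy0; rewrite b0.
have KD : (x |: K') :\ x = K' by rewrite setU1K.
have WE : W = star x (x |: K').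
  rewrite /star KD; apply/setP => w; apply/idP/imsetP => [wW'|[v + ->]].
    have wD : val x + w \in D by rewrite memD; have := qW _ wW'; rewrite /shift => ->.
    by exists (exist (fun v : T => v \in D) _ wD); rewrite ?inE /= addrA addxx add0r.
  by rewrite inE.
exists (x |: K') => //; rewrite !inE eqxx wW orbT /= andbT.
rewrite (card_star (x := x)) ?setU11 // -WE cardW eqxx /=.
apply/all_triplesP => u v w uK vK wK uv vw uw.
(* The point [x] becomes the zero vector. A triple thus has three pairs of value 1 if it avoids [x],
   and exactly one otherwise: an odd number in both cases. *)
have bE u' v' : u' \in x |: K' -> v' \in x |: K' -> u' != v' ->
    b (val x + val u') (val x + val v') = (u' != x) && (v' != x).
  rewrite !inE; have [->|u'x] := eqVneq u' x.
    by rewrite addxx b0.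
  have [->|v'x] := eqVneq v' x; first by rewrite addxx bC b0.
  by move=> u'W v'W u'v'; rewrite bW // (inj_eq (@shift_val_inj x)).
rewrite (triple_shift x) !bE //.
have [ux|_] := eqVneq u x; last have [vx|_] := eqVneq v x; last by case: (w != x).
  by rewrite -ux eq_sym uv eq_sym uw.
by rewrite -vx eq_sym vw.
Qed.

Lemma odd_sets_pair_count (x y : N) : (J <= 4)%N -> x != y ->
  #|[set K in odd_sets | (x \in K) && (y \in K)]| =
  nth 0%N [:: 0; 0; 2; 8; 64]%N J.
Proof.
move=> J_le4 xy; rewrite odd_sets_pair //.
apply: (card_cliques addxx bDl bxx bC b_nondeg (shiftD x) (shift_sum x) cardT).
- by rewrite -(addxx (val x)) (inj_eq (addrI _)) (inj_eq val_inj) eq_sym.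
- by rewrite /shift addrA addxx add0r p_val.
by rewrite J_gt1.
Qed.

Lemma odd_even_meet (K K' : {set N}) : K \in odd_sets -> K' \in even_sets ->
  (#|K :&: K'| <= 2)%N.
Proof.
rewrite !inE => /andP[_ /all_triplesP K3] /andP[_ /all_triplesP K3'].
rewrite leqNgt; apply/negP => /card_gt2P[x [y [z [[xK yK zK] [xy yz zx]]]]].
move: xK yK zK; rewrite !inE => /andP[xK xK'] /andP[yK yK'] /andP[zK zK'].
have := K3 x y z xK yK zK xy yz; have := K3' x y z xK' yK' zK' xy yz.
by rewrite eq_sym zx => -> // /(_ isT).
Qed.

Lemma cardN : #|{: N}| = (2 ^ J.-1 * (2 ^ J + 1))%N.
Proof. by rewrite card_sig -cardD; apply: eq_card => x; rewrite !inE. Qed.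

Lemma odd_even_oval (K K' : {set N}) : (J <= 4)%N ->
  K \in odd_sets -> K' \in even_sets ->
  #|K :&: K'| = 0%N \/ #|K :&: K'| = 2%N.
Proof.
move=> J_le4 Ko Ke.
have [->|/set0Pn[x]] := eqVneq (K :&: K') set0; first by left; rewrite cards0.
rewrite inE => /andP[xK xK']; right.
apply: (@meet_two _ odd_sets (2 ^ J.-1).+2 _ _ _ K' K x) => //.
- by move=> X; rewrite inE => /andP[/eqP].
- by move=> u v uv; apply: (odd_sets_pair_count J_le4 uv).
- by move=> X Xo; apply: odd_even_meet.
(* What remains is (2^J - 1)(2^(J-1) + 1) = 2^(J-1) (2^J + 1) - 1. *)
rewrite cardN; move: Ke; rewrite inE => /andP[/eqP -> _].
by case: J J_gt1 J_le4 => [|[|[|[|[|]]]]].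
Qed.

Lemma odd_sets_BIBD : (J <= 4)%N ->
  forms_BIBD odd_sets (2 ^ J.-1 * (2 ^ J + 1)) (2 ^ J.-1).+2
    (nth 0%N [:: 0; 0; 2; 8; 64]%N J) (nth 0%N [:: 0; 0; 6; 56; 960]%N J)
    (nth 0%N [:: 0; 0; 15; 336; 13056]%N J).
Proof.
move=> J_le4; apply: (@BIBD_of_counts _ _ (2 ^ J.-1).+2).
- by move=> X; rewrite inE => /andP[/eqP].
- by move=> u v; apply: odd_sets_pair_count.
- exact: cardN.
- by [].
- by [].
- by case: J J_gt1 J_le4 => [|[|[|[|[|]]]]].
- by case: J J_gt1 J_le4 => [|[|[|[|[|]]]]] // _ _; lia.
by case: J J_gt1 J_le4 => [|[|[|[|[|]]]]].
Qed.

(** Twice the indicator of the complement of [D] is [1 - sg (p u)], and the two signs multiply to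
    the character at [w]; both resulting sums over the whole space are known. *)
Lemma gram_sum (x y : N) :
  2 * \sum_(u in ~: D) sg (b u (val x)) * sg (b u (val y)) =
  2 ^+ (2 * J) *+ (x == y) - 2 ^+ J * sg (b (val x) (val y)).
Proof.
set w := val x + val y.
(* Translation by [val x] replaces [p] by [shift x], for which [w] is singular since [val y] lies in
   [D]. *)
have -> : 2 ^+ J * sg (b (val x) (val y)) = \sum_u sg (p u) * sg (b u w).
  rewrite (reindex_inj (addrI (val x))) /=.
  transitivity (\sum_u sg (shift x u) * sg (b u w) * sg (b (val x) (val y))).
    rewrite -mulr_suml.
    rewrite (sum_sg_qb bDl bxx bC (shiftD x) (shift_sum x)).
    by rewrite /shift addrA addxx add0r p_val mulr1.
  apply: eq_bigr => u _; rewrite bDl signr_addb.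
  have -> : b (val x) w = b (val x) (val y) by rewrite bDr bxx.
  by rewrite /shift; ring.
have -> : 2 ^+ (2 * J) *+ (x == y) = \sum_u sg (b u w).
  rewrite (sum_sg_b addxx bDl bC b_nondeg) cardT -natz natrX; congr (_ *+ _).
  by rewrite /w -(addxx (val x)) (inj_eq (addrI _)) (inj_eq val_inj) eq_sym.
rewrite -sumrB mulr_sumr big_mkcond; apply: eq_bigr => u _.
rewrite inE memD negbK -signr_addb -bDr -/w.
by case: (p u); case: (b u w).
Qed.

End AffineQuadric.

(** * Binders described by signs of inner products *)

Lemma bin_signE (R : realType) (E : lmodType R) (ip : {dot E for idfun})
    (N : finType) (phi : N -> E) (m : nat) (s : N -> N -> bool) :
  (1 < m)%N -> (forall n, ip (phi n) (phi n) = m%:R) ->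
  (forall u v, u != v -> ip (phi u) (phi v) = (-1) ^+ s u v) ->
  forall K, K \in bin ip phi <-> #|K| = m.+1 /\
    (forall x y z, x \in K -> y \in K -> z \in K ->
       x != y -> y != z -> x != z -> s x y (+) s y z (+) s x z = true).
Proof.
move=> m_gt1 diag off K.
have off2 u v : u != v -> ip (phi u) (phi v) ^+ 2 = 1.
  by move=> /off ->; rewrite sqrr_sign.
have m_gt1R : 1 < m%:R :> R by rewrite ltr1n.
have negE : neg_triples ip phi K <-> (forall x y z,
    x \in K -> y \in K -> z \in K ->
    x != y -> y != z -> x != z -> s x y (+) s y z (+) s x z = true).
  split=> H x y z xK yK zK xy yz xz.
    have := H x y z xK yK zK xy yz xz; rewrite !off // -!signr_addb.
    case: (_ (+) _) => // /eqP; rewrite -subr_eq0 opprK.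
    by rewrite (_ : _ + 1 = 2%:R) // pnatr_eq0.
  by rewrite !off // -!signr_addb H.
have cardE : #|K|%:R = m%:R + 1 :> R <-> #|K| = m.+1.
  by rewrite natr1; split=> [/eqP|->//]; rewrite eqr_nat => /eqP.
rewrite inE -cardE -negE; split.
  by move=> /asboolP /(simplex_neg_triples m_gt1R diag off2).
by move=> [cK nK]; apply/asboolP; apply: (neg_triples_simplex m_gt1R diag off2).
Qed.

(** * Boolean version of the symplectic space and Gram matrix of [Psi] *)

Lemma F2_cases (x : 'F_2) : x = 0 \/ x = 1.
Proof.
case: x => [[|[|n]] h]; first by left; apply: val_inj.
  by right; apply: val_inj.
by have : (n.+2 < 2)%N := h.
Qed.

Lemma F2_eq1D (x y : 'F_2) : (x + y == 1) = (x == 1) (+) (y == 1).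
Proof. by case: (F2_cases x) (F2_cases y) => -> [] ->. Qed.

Lemma F2_eq0 (x : 'F_2) : (x == 0) = ~~ (x == 1).
Proof. by case: (F2_cases x) => ->. Qed.

Lemma F2_natE (x : 'F_2) : nat_of_ord x = (x == 1).
Proof. by case: (F2_cases x) => ->. Qed.

Definition form_bit (V : vectType 'F_2) (B : {skew_symmetric V})
  (x y : finvect_type V) : bool := B x y == 1.

Section SymplecticSpace.

Variables (V : vectType 'F_2) (B : {skew_symmetric V}).
Hypothesis hB : is_psymplectic B.

Local Notation T := (finvect_type V).
Local Notation b := (form_bit B).

Lemma addxx_F2 (x : T) : x + x = 0.
Proof.
rewrite -[x](@scale1r _ V) -(@scalerDl _ V) (_ : 1 + 1 = 0) ?(@scale0r _ V) //.
exact/val_inj.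
Qed.

Lemma form_bDl (x y z : T) : b (x + y) z = b x z (+) b y z.
Proof. by rewrite /form_bit linearDl F2_eq1D. Qed.

Lemma form_bxx (x : T) : b x x = false.
Proof. by case: hB => _ _ /(_ isT x) Bxx; rewrite /form_bit Bxx. Qed.

Lemma form_bC (x y : T) : b x y = b y x.
Proof.
have := form_bxx (x + y); rewrite /form_bit linearDl !linearDr !F2_eq1D.
rewrite -!/(b _ _) !form_bxx.
by case: (b x y); case: (b y x).
Qed.

Lemma form_nondeg (u : T) : u != 0 -> exists w, b w u.
Proof.
case: hB => /eqP rad0 _ _ u0.
have /mem_orthovPn[w _ uw] : (u : V) \notin orthov B fullv.
  by rewrite rad0 memv0.
by exists w; rewrite form_bC /form_bit; move: uw; rewrite F2_eq0 negbK.
Qed.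

Variable D : {set finvect_type V}.
Hypothesis hD : affine_quadric B D.

Local Notation p := (fun x : T => x \notin D).

(** The bit [c] records whether [D] or its complement is the quadric; it equals [p 0] because
    [Q 0 = 0]. *)
Lemma affine_quadricD (x y : T) : p (x + y) = p x (+) p y (+) p 0 (+) b x y.
Proof.
case: hD => Q [QB DE].
have [c pE] : exists c, forall v : T, p v = (Q v == 1) (+) c.
  case: DE => DE; [exists false|exists true] => v.
    by rewrite DE inE F2_eq0 negbK addbF.
  by rewrite -in_setC DE inE F2_eq0 addbT.
rewrite !pE /form_bit QB !F2_eq1D.
have -> : (Q 0 == 1) = false.
  have := QB 0 0; rewrite linear0l add0r => /(congr1 (fun z => z == 1)).
  by rewrite !F2_eq1D addbb addFb.
by case: (Q (x + y) == 1); case: (Q x == 1); case: (Q y == 1); case: (c).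
Qed.

Variable J : nat.
Hypothesis J_gt1 : (1 < J)%N.
Hypothesis dimV : \dim {:V} = (2 * J)%N.
Hypothesis cardD : #|D| = (2 ^ J.-1 * (2 ^ J + 1))%N.

Lemma card_F2_space : #|T| = (2 ^ (2 * J))%N.
Proof.
have := @card_vspacef 'F_2 (finvect_type V) (Vector.class V).
rewrite card_vspace card_Fp //.
by rewrite (dimV : \dim (fullv : {vspace finvect_type V}) = _) => <-.
Qed.

Lemma memD_p (x : T) : (x \in D) = ~~ p x.
Proof. by rewrite negbK. Qed.

Variable R : realType.

Lemma sgBE (x y : T) : sgB B R x y = (-1) ^+ b x y.
Proof. by rewrite /sgB F2_natE. Qed.

(** The integer identity [gram_sum] is carried to [R] and divided by 2^J: a factor 2 from that
    identity and 2^(J-1) from the normalisation of [Psi]. *)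
Lemma Psi_gram (x y : {v | v \in D}) :
  dotf (Psi B R J x) (Psi B R J y) =
  if x == y then (2 ^ J).-1%:R else (-1) ^+ ~~ b (val x) (val y).
Proof.
have E : 2 * \sum_(u in ~: D) sgB B R u (val x) * sgB B R u (val y) =
    2 ^+ (2 * J) *+ (x == y) - 2 ^+ J * (-1) ^+ b (val x) (val y) :> R.
  have := gram_sum addxx_F2 form_bDl form_bxx form_bC form_nondeg
    affine_quadricD J_gt1 card_F2_space memD_p cardD x y.
  move=> /(congr1 (fun z : int => z%:~R : R)).
  have -> : (2 ^+ (2 * J) *+ (x == y) - 2 ^+ J * (-1) ^+ b (val x) (val y))%:~R
      = 2 ^+ (2 * J) *+ (x == y) - 2 ^+ J * (-1) ^+ b (val x) (val y) :> R.
    rewrite rmorphB rmorphM !rmorphXn /= rmorphN1; congr (_ - _).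
    by case: (x == y); rewrite // mulr1n rmorphXn.
  move=> <-; rewrite rmorphM rmorph_sum /=; congr (_ * _).
  apply: eq_bigr => u _.
  by rewrite !sgBE rmorphM !rmorphXn /= rmorphN1.
rewrite /dotf.
under eq_bigr => u _ do rewrite !ffunE mulrACA.
rewrite -mulr_sumr.
rewrite -(big_sub (mem (~: D))
  (fun u : T => sgB B R u (val x) * sgB B R u (val y))).
set S := \sum_(u in _) _ in E *.
have -> : Num.sqrt 2 ^- J.-1 * Num.sqrt 2 ^- J.-1 = 2 ^- J.-1 :> R.
  by rewrite -invfM -exprMn -expr2 sqr_sqrtr.
have pow_neq0 : 2 ^+ J.-1 != 0 :> R by rewrite expf_neq0 // pnatr_eq0.
apply: (mulfI pow_neq0); rewrite mulVKf //.
apply: (mulfI (x := 2)); rewrite ?pnatr_eq0 // E mulrA -exprS prednK 1?ltnW //.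
have [->|xy] := eqVneq x y.
  rewrite form_bxx mulr1 mulr1n mul2n -addnn exprD -subn1 natrB ?expn_gt0 //.
  by rewrite natrX mulrBr mulr1.
by rewrite mulr0n sub0r; case: (b _ _); rewrite /= ?expr0 ?expr1 ?mulrN ?mulr1 ?opprK.
Qed.

End SymplecticSpace.

Theorem theorem5p12 (R : realType) (J : nat) (hJ : (2 <= J)%N)
    (V : vectType 'F_2) (dimV : \dim {:V} = (2 * J)%N)
    (B : {skew_symmetric V}) (hB : is_psymplectic B)
    (D : {set finvect_type V}) (hD : affine_quadric B D)
    (cardD : #|D| = (2 ^ J.-1 * (2 ^ J + 1))%N)
    (E : lmodType R) (ip : {dot E for idfun})
    (hPsi : {v | v \in D} -> E) (hdual : is_dual_Psi B J ip hPsi) :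
  let bPsi := bin (@euclidean R _) (@Psi V B R J D) in
  let bhPsi := bin ip hPsi in
  [/\ (4 < J)%N -> bhPsi = set0,
      [/\ J = 2%N -> forms_BIBD bhPsi 10 4 2 6 15,
          J = 3%N -> forms_BIBD bhPsi 36 6 8 56 336
        & J = 4%N -> forms_BIBD bhPsi 136 10 64 960 13056]
    & (J <= 4)%N ->
        (forall K, K \in bPsi -> oval (enum bhPsi) K) /\
        (forall K, K \in bhPsi -> oval (enum bPsi) K)].
Proof.
move=> bPsi bhPsi.
pose b := form_bit B.
have bhPsiE : bhPsi = odd_sets b J D.
  have m_gt1 : (1 < (2 ^ J.-1).+1)%N by rewrite ltnS expn_gt0.
  have diag n : ip (hPsi n) (hPsi n) = (2 ^ J.-1).+1%:R.
    by rewrite hdual eqxx -[in RHS]natr1 natrX.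
  have off u v : u != v ->
      ip (hPsi u) (hPsi v) = (-1) ^+ b (val u) (val v).
    by move=> /negPf uv; rewrite hdual uv sgBE.
  have binE := bin_signE m_gt1 diag off.
  apply/setP => K; apply/idP/idP => [/binE[cK tK]|].
    by rewrite inE cK eqxx; apply/all_triplesP.
  by rewrite inE => /andP[/eqP cK /all_triplesP tK]; apply/binE.
have bPsiE : bPsi = even_sets b J D.
  have J2 : (2 ^ J = 2 * 2 ^ J.-1)%N by rewrite -expnS prednK // ltnW.
  have J1 : (2 <= 2 ^ J.-1)%N.
    by rewrite -{1}(expn1 2) leq_exp2l // -ltnS prednK // ltnW.
  have m_gt1 : (1 < (2 ^ J).-1)%N by lia.
  have diag (n : {v | v \in D}) :
      euclidean R _ (Psi B R J n) (Psi B R J n) = (2 ^ J).-1%:R.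
    by rewrite [LHS](Psi_gram hB hD hJ dimV cardD) eqxx.
  have off (u v : {v | v \in D}) : u != v ->
      euclidean R _ (Psi B R J u) (Psi B R J v) = (-1) ^+ ~~ b (val u) (val v).
    by move=> /negPf uv; rewrite [LHS](Psi_gram hB hD hJ dimV cardD) uv.
  have binE := bin_signE m_gt1 diag off.
  (* Off the diagonal, the signs for [Psi] are opposite to those of [b]. Three negations flip the
     parity, so the odd condition of [bin_signE] becomes the even one. *)
  have negE (x y z : {v | v \in D}) :
      ~~ b (val x) (val y) (+) ~~ b (val y) (val z) (+) ~~ b (val x) (val z)
      = ~~ triple b x y z.
    by rewrite !(addNb, addbN) negbK.
  have cE : (2 ^ J).-1.+1 = (2 ^ J)%N by lia.
  apply/setP => K; apply/idP/idP => [/binE[cK tK]|].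
    rewrite inE cK cE eqxx; apply/all_triplesP => x y z xK yK zK xy yz xz.
    by apply: negbTE; rewrite -negE tK.
  rewrite inE => /andP[/eqP cK /all_triplesP tK]; apply/binE.
  by rewrite cE; split=> // x y z xK yK zK xy yz xz; rewrite negE tK.
(* The intersection statement is symmetric and serves both oval claims. *)
have meet := odd_even_oval (@addxx_F2 V) (form_bDl B) (form_bxx hB)
  (form_bC hB) (form_nondeg hB) (affine_quadricD hD) hJ (card_F2_space dimV)
  (memD_p D) cardD.
have BIBD := odd_sets_BIBD (@addxx_F2 V) (form_bDl B) (form_bxx hB)
  (form_bC hB) (form_nondeg hB) (affine_quadricD hD) hJ (card_F2_space dimV)
  (memD_p D) cardD.
rewrite bhPsiE bPsiE; split.
- exact: (odd_sets_eq0 (@addxx_F2 V) (form_bDl B) (form_bxx hB) (form_bC hB)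
    hJ (card_F2_space dimV) (memD_p D)).
- by split=> JE; rewrite JE in BIBD *; apply: BIBD.
move=> J_le4; split=> K KE; split.
- by move: KE; rewrite inE -card_gt0 => /andP[/eqP -> _]; rewrite expn_gt0.
- by move=> X; rewrite mem_enum setIC => XE; apply: meet.
- by move: KE; rewrite inE -card_gt0 => /andP[/eqP -> _].
by move=> X; rewrite mem_enum => XE; apply: meet.
Qed.
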